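(* Let $A_1A_2A_3A_4$ be a quadrilateral inscribed in a nondegenerate conic $\mathcal{C}$, and let $R_1,\dots,R_{16}$ be the sixteen points associated with it as defined in the context. Then each of the following six groups of $8$ points lies on a common conic: \begin{itemize} \item $\{R_1,R_2,R_3,R_4,R_5,R_6,R_7,R_8\}$, \item $\{R_9,R_{10},R_{11},R_{12},R_{13},R_{14},R_{15},R_{16}\}$, \item $\{R_1,R_2,R_5,R_6,R_{11},R_{12},R_{15},R_{16}\}$, \item $\{R_3,R_4,R_7,R_8,R_9,R_{10},R_{13},R_{14}\}$, \item $\{R_1,R_3,R_5,R_7,R_9,R_{11},R_{13},R_{15}\}$, \item $\{R_2,R_4,R_6,R_8,R_{10},R_{12},R_{14},R_{16}\}$. \end{itemize}
   Context: The ambient plane is the complex projective plane (real configurations being included), and $A_1,A_2,A_3,A_4$ are four distinct points of the nondegenerate conic $\mathcal{C}$. A conic is the zero locus of a nonzero homogeneous quadratic form (the conics in the conclusion may be degenerate). For distinct points $P,Q$, $l(PQ)$ denotes the line through them. Let $t_i$ be the tangent line to $\mathcal{C}$ at $A_i$. Let $M_1=l(A_1A_2)\cap l(A_3A_4)$ and $M_2=l(A_2A_3)\cap l(A_4A_1)$. Let $N_1=t_1\cap t_2$, $P_1=t_3\cap t_4$, $N_2=t_1\cap t_4$, $P_2=t_2\cap t_3$. Let $U_1,U_2$ be the two points where the tangent lines from $M_1$ touch $\mathcal{C}$, and $V_1,V_2$ the two points where the tangent lines from $M_2$ touch $\mathcal{C}$. Let $Z_1=l(M_1U_1)\cap l(M_2V_1)$,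 $Z_2=l(M_1U_1)\cap l(M_2V_2)$, $Z_3=l(M_1U_2)\cap l(M_2V_2)$, $Z_4=l(M_1U_2)\cap l(M_2V_1)$. Define $R_1=l(Z_1Z_2)\cap l(N_1N_2)$, $R_2=l(Z_1Z_2)\cap l(N_1P_2)$, $R_3=l(Z_2Z_3)\cap l(N_1P_2)$, $R_4=l(Z_2Z_3)\cap l(P_1P_2)$, $R_5=l(Z_3Z_4)\cap l(P_1P_2)$, $R_6=l(Z_3Z_4)\cap l(P_1N_2)$, $R_7=l(Z_1Z_4)\cap l(P_1N_2)$, $R_8=l(Z_1Z_4)\cap l(N_1N_2)$, $R_9=l(Z_1Z_2)\cap l(P_1P_2)$, $R_{10}=l(Z_3Z_4)\cap l(N_1P_2)$, $R_{11}=l(Z_2Z_3)\cap l(P_1N_2)$, $R_{12}=l(Z_1Z_4)\cap l(P_1P_2)$, $R_{13}=l(Z_3Z_4)\cap l(N_1N_2)$, $R_{14}=l(Z_1Z_2)\cap l(P_1N_2)$, $R_{15}=l(Z_1Z_4)\cap l(N_1P_2)$, $R_{16}=l(Z_2Z_3)\cap l(N_1N_2)$. *)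

(* Defs.v *)
From mathcomp Require Import all_boot all_order all_algebra.
From mathcomp Require Import complex reals.

Set Implicit Arguments.
Unset Strict Implicit.
Unset Printing Implicit Defensive.

Import GRing.Theory.
Local Open Scope ring_scope.

(* The projective plane over F is the lattice of subspaces of F^3: points are
   the subspaces of dimension 1, lines those of dimension 2.  A conic is given
   by the symmetric 3 x 3 matrix Q of its quadratic form v |-> v Q v^T (up to a
   scalar; every quadratic form has such a matrix when 2 is invertible). *)
Section ProjectivePlane.
Variable F : fieldType.
Implicit Types (P L M U : {vspace 'rV[F]_3}) (Q : 'M[F]_3).

Definition is_point P : Prop := \dim P = 1%N.

(* For points P != P', the line l(PP'). *)
Definition line P P' : {vspace 'rV[F]_3} := (P + P')%VS.

(* For lines L != L', their common point. *)
Definition meet L L' : {vspace 'rV[F]_3} := (L :&: L')%VS.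

Definition is_conic Q : Prop := Q^T = Q /\ Q != 0.

Definition nondegenerate_conic Q : Prop := Q^T = Q /\ \det Q != 0.

Definition on_conic Q P : Prop :=
  is_point P /\ (forall v, v \in P -> v *m Q *m v^T = 0).

(* The gradient of v |-> v Q v^T at a is 2 Q a^T, so the tangent line at the
   point spanned by a is {v | v Q a^T = 0}.  Here a := vpick P is a nonzero
   vector of P; when P is a point, the kernel does not depend on its choice. *)
Definition tangent Q P : {vspace 'rV[F]_3} :=
  lker (linfun (mulmxr (Q *m (vpick P)^T) : 'rV[F]_3 -> 'M[F]_1)).

(* U is the point of contact of a tangent line drawn from M to the conic. *)
Definition contact_point Q M U : Prop :=
  on_conic Q U /\ (M <= tangent Q U)%VS.

Definition on_common_conic (s : seq {vspace 'rV[F]_3}) : Prop :=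
  exists Q, is_conic Q /\ (forall P, P \in s -> on_conic Q P).

End ProjectivePlane.

(* Main.v *)
(* A frame on the vertices of the diagonal triangle puts the four points at
   [(+-1, +-1, 1)] and makes the conic diagonal.  The contact points of the
   tangents from [M1] and [M2] are then [(0, 1, +-e)] and [(1, 0, +-f)], the conic
   is [f^2 x^2 + e^2 y^2 = z^2], and [e^2 + f^2 = 1] since it passes through
   [(1, 1, 1)].  The lines [l(N1 N2)], [l(N1 P2)], [l(P1 P2)], [l(P1 N2)] are
   [t1], [t2], [t3], [t4], so the sixteen points are the intersections of the
   lines [z = +-e y], [z = +-f x] with the four tangents
   [+-f^2 x +- e^2 y = z].  They form four orbits under the sign changes of [x]
   and [y]; each of the first four groups is the union of two orbits, and a
   diagonal conic through a point of each orbit exists by counting parameters.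
   The last two groups lie on
   [f^4 x^2 - e^4 y^2 + (e^2 - f^2) z^2 +- 2 e^2 f^2 x y = 0]. *)

Require Import Defs.
From mathcomp Require Import all_boot all_order all_algebra.
From mathcomp Require Import complex reals.
From mathcomp Require Import ring.

Set Implicit Arguments.
Unset Strict Implicit.
Unset Printing Implicit Defensive.

Import GRing.Theory.
Local Open Scope ring_scope.

(** * Coordinate vectors and the cross product in dimension three *)

Section Vec3.
Variable F : fieldType.
Implicit Types (u v w : 'rV[F]_3).

Definition vec3 (x y z : F) : 'rV[F]_3 := \row_(j < 3) [:: x; y; z]`_j.

Lemma vec3P u : exists x y z, u = vec3 x y z.
Proof.
exists (u 0 0), (u 0 1), (u 0 2); apply/rowP => i; rewrite mxE.
by case: i => [[|[|[|//]]] lti]; congr (u 0 _); apply: val_inj.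
Qed.

Lemma vec3_inj x y z x' y' z' :
  vec3 x y z = vec3 x' y' z' -> [/\ x = x', y = y' & z = z'].
Proof.
move=> /rowP e; have e0 := e 0; have e1 := e 1; have e2 := e 2.
by rewrite !mxE /= in e0 e1 e2.
Qed.

Lemma vec3_eq0 x y z : (vec3 x y z == 0) = [&& x == 0, y == 0 & z == 0].
Proof.
have ->: 0 = vec3 0 0 0.
  by apply/rowP => i; rewrite !mxE; case: i => [[|[|[|//]]] lti].
apply/eqP/and3P => [/vec3_inj[-> -> ->] | [/eqP-> /eqP-> /eqP->]] //.
Qed.

Lemma scale_vec3 k x y z : k *: vec3 x y z = vec3 (k * x) (k * y) (k * z).
Proof. by apply/rowP => i; rewrite !mxE; case: i => [[|[|[|//]]] lti]. Qed.

Lemma mul_vec3_tr x y z x' y' z' :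
  vec3 x y z *m (vec3 x' y' z')^T = (x * x' + y * y' + z * z')%:M.
Proof.
apply/matrixP => i j; rewrite !ord1 !mxE !big_ord_recl big_ord0 !mxE /=.
by rewrite addr0 addrA.
Qed.

Lemma mul_vec3_diag x y z a b c :
  vec3 x y z *m diag_mx (vec3 a b c) = vec3 (x * a) (y * b) (z * c).
Proof.
rewrite mul_mx_diag; apply/rowP => i; rewrite !mxE.
by case: i => [[|[|[|//]]] lti].
Qed.

Definition cross u v : 'rV[F]_3 :=
  vec3 (u 0 1 * v 0 2 - u 0 2 * v 0 1)
       (u 0 2 * v 0 0 - u 0 0 * v 0 2)
       (u 0 0 * v 0 1 - u 0 1 * v 0 0).

Lemma cross_vec3 x y z x' y' z' : cross (vec3 x y z) (vec3 x' y' z') =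
  vec3 (y * z' - z * y') (z * x' - x * z') (x * y' - y * x').
Proof. by rewrite /cross !mxE. Qed.

(** All 2 x 2 minors of the pair vanish, so the quotient of the coordinates at a nonzero coordinate
    of [c] serves as [k]. *)
Lemma cross_eq0 u c : c != 0 -> cross u c = 0 -> exists k, u = k *: c.
Proof.
have [x [y [z ->]]] := vec3P u; have [p [q [r ->]]] := vec3P c.
rewrite cross_vec3 vec3_eq0 => c0 /eqP; rewrite vec3_eq0.
move=> /and3P[]; rewrite !subr_eq0 => /eqP h1 /eqP h2 /eqP h3.
have [p0|p0] := eqVneq p 0; last first.
  exists (x / p); rewrite scale_vec3; congr vec3; apply: (mulIf p0);
  by rewrite mulrAC divfK // -?h2 -?h3 // mulrC.
have [q0|q0] := eqVneq q 0; last first.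
  exists (y / q); rewrite scale_vec3; congr vec3; apply: (mulIf q0);
  by rewrite mulrAC divfK // -?h1 ?h3 // mulrC.
have r0 : r != 0 by move: c0; rewrite p0 q0 eqxx.
exists (z / r); rewrite scale_vec3; congr vec3; apply: (mulIf r0);
  by rewrite mulrAC divfK // ?h1 -?h2 // mulrC.
Qed.

Lemma dot_cross_l u v : cross u v *m u^T = 0.
Proof.
have [x [y [z ->]]] := vec3P u; have [p [q [r ->]]] := vec3P v.
rewrite cross_vec3 mul_vec3_tr (_ : _ + _ = 0) ?raddf0 //; ring.
Qed.

Lemma dot_cross_r u v : cross u v *m v^T = 0.
Proof.
have [x [y [z ->]]] := vec3P u; have [p [q [r ->]]] := vec3P v.
rewrite cross_vec3 mul_vec3_tr (_ : _ + _ = 0) ?raddf0 //; ring.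
Qed.

Lemma dotC u v : u *m v^T = v *m u^T.
Proof.
have [x [y [z ->]]] := vec3P u; have [p [q [r ->]]] := vec3P v.
by rewrite !mul_vec3_tr (mulrC x) (mulrC y) (mulrC z).
Qed.

Lemma crossZl k u v : cross (k *: u) v = k *: cross u v.
Proof.
have [x [y [z ->]]] := vec3P u; have [p [q [r ->]]] := vec3P v.
by rewrite scale_vec3 !cross_vec3 scale_vec3; congr vec3; ring.
Qed.

Lemma crossvv v : cross v v = 0.
Proof.
have [x [y [z ->]]] := vec3P v.
rewrite cross_vec3; apply/eqP; rewrite vec3_eq0.
by apply/and3P; split; apply/eqP; ring.
Qed.

(** By the expansion [u x (v x w) = (u.w) v - (u.v) w], checked below coordinate by coordinate. *)
Lemma cross_cross u v w : u *m v^T = 0 -> u *m w^T = 0 -> cross u (cross v w) = 0.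
Proof.
have [x [y [z ->]]] := vec3P u; have [p [q [r ->]]] := vec3P v.
have [a [b [c ->]]] := vec3P w; rewrite !cross_vec3 !mul_vec3_tr.
move=> /(congr1 (fun M : 'M_1 => M 0 0)); rewrite !mxE /= mulr1n => h1.
move=> /(congr1 (fun M : 'M_1 => M 0 0)); rewrite !mxE /= mulr1n => h2.
apply/eqP; rewrite vec3_eq0; apply/and3P; split; apply/eqP.
- transitivity (p * (x * a + y * b + z * c) - a * (x * p + y * q + z * r)).
    ring.
  by rewrite h1 h2; ring.
- transitivity (q * (x * a + y * b + z * c) - b * (x * p + y * q + z * r)).
    ring.
  by rewrite h1 h2; ring.
- transitivity (r * (x * a + y * b + z * c) - c * (x * p + y * q + z * r)).
    ring.
  by rewrite h1 h2; ring.
Qed.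

(** The scalar is the determinant of [u], [v], [w]. Read dually, the join of the meets of a line [u]
    with two other lines is [u] again, provided that the three are not concurrent. *)
Lemma cross_cross_l u v w :
  cross (cross u v) (cross u w) = (cross u v *m w^T) 0 0 *: u.
Proof.
have [x [y [z ->]]] := vec3P u; have [p [q [r ->]]] := vec3P v.
have [a [b [c ->]]] := vec3P w.
by rewrite !cross_vec3 mul_vec3_tr mxE mulr1n scale_vec3; congr vec3; ring.
Qed.

Lemma vlineZ k (u : 'rV[F]_3) : k != 0 -> <[k *: u]>%VS = <[u]>%VS.
Proof.
move=> k0; apply/vspaceP => v; apply/vlineP/vlineP => -[c ->].
  by exists (c * k); rewrite scalerA.
by exists (c / k); rewrite scalerA divfK.
Qed.

End Vec3.

(** * Points, lines, tangents and conics in the coordinates of a frame *)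

Section Frame.
Variables (F : fieldType) (E : 'M[F]_3).
Hypothesis unitE : E \in unitmx.
Implicit Types (u v w : 'rV[F]_3).

(** The rows of [E] serve as a basis: [u] and [w] are the coordinates of a point and of a line in
    it, and the factor [invmx E] in [ln] turns incidence into [u *m w^T = 0]. *)
Definition pt u : {vspace 'rV[F]_3} := <[u *m E]>%VS.
Definition ln w : {vspace 'rV[F]_3} :=
  lker (linfun (mulmxr (invmx E *m w^T) : 'rV[F]_3 -> 'M[F]_1)).

Lemma mem_ln v w : (v *m E \in ln w) = (v *m w^T == 0).
Proof. by rewrite memv_ker lfunE /= mulmxA mulmxK. Qed.

Lemma frameP v : exists u, v = u *m E.
Proof. by exists (v *m invmx E); rewrite mulmxKV. Qed.

Lemma frame_eq0 u : (u *m E == 0) = (u == 0).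
Proof.
apply/eqP/eqP => [e|->]; last by rewrite mul0mx.
by rewrite -[u](mulmxK unitE) e mul0mx.
Qed.

Lemma pt_sub_ln u w : (pt u <= ln w)%VS = (u *m w^T == 0).
Proof. by rewrite -mem_ln memvE. Qed.

Lemma ptZ k u : k != 0 -> pt (k *: u) = pt u.
Proof. by move=> k0; rewrite /pt -scalemxAl vlineZ. Qed.

Lemma lnZ k w : k != 0 -> ln (k *: w) = ln w.
Proof.
move=> k0; apply/vspaceP => v; have [u ->] := frameP v.
by rewrite !mem_ln linearZ /= -scalemxAr scalemx_eq0 (negPf k0).
Qed.

Lemma dim_pt u : u != 0 -> \dim (pt u) = 1%N.
Proof. by move=> u0; rewrite dim_vline frame_eq0 u0. Qed.

Lemma dim_ln w : w != 0 -> \dim (ln w) = 2.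
Proof.
move=> w0.
have := limg_ker_dim (linfun (mulmxr (invmx E *m w^T) : 'rV[F]_3 -> 'M[F]_1)) fullv.
rewrite capfv -/(ln w) dimvf /dim /= => dim3.
set I := (_ @: _)%VS in dim3.
suff: \dim I = 1%N by move: dim3 => /[swap] ->; rewrite addn1 => -[].
apply/eqP; rewrite eqn_leq; apply/andP; split.
  by rewrite (leq_trans (dimvS (subvf I))) // dimvf.
rewrite lt0n dimv_eq0; apply: contra w0 => /eqP I0.
(* With a zero image, [w] would be orthogonal to every vector, in particular to the standard
   basis. *)
have w_perp u : u *m w^T = 0.
  apply/eqP; rewrite -memv0 -I0.
  have <- : linfun (mulmxr (invmx E *m w^T) : 'rV[F]_3 -> 'M[F]_1) (u *m E)
    = u *m w^T by rewrite lfunE /= mulmxA mulmxK.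
  exact: memv_img (memvf _).
apply/eqP/rowP => i; have := w_perp (delta_mx 0 i).
by rewrite -rowE => /matrixP/(_ 0 0); rewrite !mxE.
Qed.

(** A vector orthogonal to both [w] and [w'] has zero cross product with [cross w w'], hence is a
    multiple of it. *)
Lemma meet_ln w w' : cross w w' != 0 -> meet (ln w) (ln w') = pt (cross w w').
Proof.
move=> c0; apply/vspaceP => v; have [u ->] := frameP v.
rewrite memv_cap !mem_ln; apply/andP/vlineP => [[/eqP h1 /eqP h2]|[k]].
  have [k ->] := cross_eq0 c0 (cross_cross h1 h2).
  by exists k; rewrite scalemxAl.
rewrite scalemxAl => /(can_inj (mulmxK unitE)) ->.
by rewrite -!scalemxAl dot_cross_l dot_cross_r scaler0 eqxx.
Qed.

(** Both points lie on the line, and the nonzero cross product makes them independent, so their sum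
    has the dimension 2 of the line. *)
Lemma line_pt u v : cross u v != 0 -> line (pt u) (pt v) = ln (cross u v).
Proof.
move=> c0; have v0 : v != 0.
  apply: contraNneq c0 => ->; rewrite vec3_eq0 !mxE.
  by rewrite !mulr0 subr0 eqxx.
have u0 : u != 0.
  apply: contraNneq c0 => ->; rewrite vec3_eq0 !mxE.
  by rewrite !mul0r subr0 eqxx.
apply/eqP; rewrite eqEdim; apply/andP; split.
  by rewrite subv_add !pt_sub_ln !(dotC _ (cross u v)) dot_cross_l dot_cross_r eqxx.
rewrite dim_ln // dimv_disjoint_sum ?dim_pt //.
apply/eqP; rewrite -subv0; apply/subvP => x; rewrite memv_cap.
case/andP => /vlineP[k ->] /vlineP[l].
rewrite !scalemxAl => /(can_inj (mulmxK unitE)) e; rewrite memv0 frame_eq0.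
have: cross (k *: u) v = 0.
  by rewrite e crossZl crossvv scaler0.
rewrite crossZl => /eqP; rewrite scaler_eq0 (negPf c0) orbF => /eqP ->.
by rewrite scale0r.
Qed.

Lemma line_meets w w' w'' : (cross w w' *m w''^T) 0 0 != 0 ->
  line (meet (ln w) (ln w')) (meet (ln w) (ln w'')) = ln w.
Proof.
have [x [y [z ->]]] := vec3P w; have [p [q [r ->]]] := vec3P w'.
have [a [b [c ->]]] := vec3P w''.
move=> d0; move: (d0); rewrite cross_vec3 mul_vec3_tr mxE mulr1n => d1.
have c0 : cross (vec3 x y z) (vec3 p q r) != 0.
  by apply: contraNneq d0 => ->; rewrite mul0mx mxE.
have c0' : cross (vec3 x y z) (vec3 a b c) != 0.
  apply: contraNneq d1 => /eqP; rewrite cross_vec3 vec3_eq0.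
  move=> /and3P[/eqP h1 /eqP h2 /eqP h3]; apply/eqP.
  (* The determinant is, up to sign, the scalar product of [w'] with the cross product of [w] and
     [w'']. *)
  transitivity (- (p * (y * c - z * b) + q * (z * a - x * c)
                     + r * (x * b - y * a))); first by ring.
  by rewrite h1 h2 h3; ring.
have w0 : vec3 x y z != 0.
  apply: contraNneq d1 => /eqP; rewrite vec3_eq0.
  by move=> /and3P[/eqP-> /eqP-> /eqP->]; apply/eqP; ring.
rewrite !meet_ln // line_pt cross_cross_l ?lnZ //.
by rewrite scaler_eq0 (negPf d0).
Qed.

Lemma ptP P : is_point P -> exists2 u, u != 0 & P = pt u.
Proof.
move=> dimP; have [u eu] := frameP (vpick P).
have P0 : P != 0%VS by rewrite -dimv_eq0 dimP.
have u0 : u != 0 by rewrite -frame_eq0 -eu vpick0.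
exists u => //; apply/eqP; rewrite eq_sym eqEdim dim_pt // dimP andbT.
by rewrite -memvE -eu memv_pick.
Qed.

Lemma on_conic_pt Q u :
  on_conic Q (pt u) -> u *m (E *m Q *m E^T) *m u^T = 0.
Proof.
case=> _ /(_ _ (memv_line _)) <-.
by rewrite trmx_mul !mulmxA.
Qed.

Lemma pt_on_conic C u : u != 0 -> u *m C *m u^T = 0 ->
  on_conic (invmx E *m C *m (invmx E)^T) (pt u).
Proof.
move=> u0 e; split; first exact: dim_pt.
move=> v /vlineP[k ->]; rewrite -scalemxAl linearZ /= -!scalemxAl -scalemxAr.
rewrite trmx_mul !mulmxA mulmxK // -(mulmxA (u *m C)) -trmx_mul mulmxV //.
by rewrite trmx1 mulmx1 e !scaler0.
Qed.

(** In frame coordinates the form has matrix [E *m Q *m E^T], and the tangent is the polar of [u].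
    The vector picked in [pt u] is a nonzero multiple of [u *m E], which leaves the kernel
    unchanged. *)
Lemma tangent_pt Q d u : E *m Q *m E^T = diag_mx d -> u != 0 ->
  tangent Q (pt u) = ln (u *m diag_mx d).
Proof.
move=> eqD u0; apply/vspaceP => v; have [x ->] := frameP v.
have /vlineP[k ek] := memv_pick (pt u).
have k0 : k != 0.
  have: vpick (pt u) != 0 by rewrite vpick0 -dimv_eq0 dim_pt.
  by rewrite ek; apply: contraNneq => ->; rewrite scale0r.
rewrite [RHS]mem_ln /tangent memv_ker lfunE /= ek.
rewrite linearZ /= -!scalemxAr scalemx_eq0 (negPf k0) orFb.
rewrite !trmx_mul tr_diag_mx -eqD.
by rewrite !mulmxA.
Qed.

End Frame.

(** * Diagonal form of a nondegenerate conic through four points *)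

Section NormalForm.
Variable F : fieldType.

Lemma exists_kernel m n (A : 'M[F]_(m, n)) : (n < m)%N ->
  exists2 v : 'rV_m, v != 0 & v *m A = 0.
Proof.
move=> ltnm; have : kermx A != 0.
  rewrite kermx_eq0 /row_free neq_ltn.
  by rewrite (leq_ltn_trans (rank_leq_col A) ltnm).
by case/rowV0Pn => v /sub_kermxP vA v0; exists v.
Qed.

Lemma exists_orthogonal (u v : 'rV[F]_3) :
  exists a b c, vec3 a b c != 0 /\ vec3 a b c *m u^T = 0 /\ vec3 a b c *m v^T = 0.
Proof.
have [//|w w0] := @exists_kernel 3 (1 + 1) (row_mx u^T v^T).
rewrite mul_mx_row => /eqP; rewrite row_mx_eq0 => /andP[/eqP wu /eqP wv].
by have [a [b [c ew]]] := vec3P w; exists a, b, c; rewrite -ew.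
Qed.

Definition mx3 (u v w : 'rV[F]_3) : 'M[F]_3 :=
  \matrix_(i < 3) [:: u; v; w]`_i.

Lemma mul_vec3_mx3 x y z u v w :
  vec3 x y z *m mx3 u v w = x *: u + y *: v + z *: w.
Proof.
rewrite mulmx_sum_row !big_ord_recl big_ord0 addr0 addrA !mxE.
by rewrite !rowK.
Qed.

Variable Q : 'M[F]_3.
Hypothesis symQ : Q^T = Q.

Definition bil (u v : 'rV[F]_3) : F := (u *m Q *m v^T) 0 0.

Lemma bilC u v : bil u v = bil v u.
Proof.
have e : (u *m Q *m v^T)^T = v *m Q *m u^T.
  by rewrite !trmx_mul trmxK symQ mulmxA.
by rewrite /bil -e [RHS]mxE.
Qed.

Lemma bilDl u v w : bil (u + v) w = bil u w + bil v w.
Proof. by rewrite /bil !mulmxDl mxE. Qed.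

Lemma bilZl k u w : bil (k *: u) w = k * bil u w.
Proof. by rewrite /bil -!scalemxAl mxE. Qed.

Lemma bilDr u v w : bil w (u + v) = bil w u + bil w v.
Proof. by rewrite !(bilC w) bilDl. Qed.

Lemma bilZr k u w : bil w (k *: u) = k * bil w u.
Proof. by rewrite !(bilC w) bilZl. Qed.

Lemma bil0l w : bil 0 w = 0.
Proof. by rewrite /bil !mul0mx mxE. Qed.

Lemma bil_mx u v : u *m Q *m v^T = (bil u v)%:M.
Proof. exact: mx11_scalar. Qed.

Definition bilE := (bilDl, bilDr, bilZl, bilZr).

(** A nondegenerate conic contains no line. If [u] and [v] were independent, [u *m Q] and [v *m Q]
    would both be orthogonal to [u] and [v], hence multiples of [cross u v]; inverting [Q] would
    make [u] and [v] proportional. *)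
Lemma isotropic_span u v : Q \in unitmx -> u != 0 -> v != 0 ->
  bil u u = 0 -> bil v v = 0 -> bil u v = 0 -> <[u]>%VS = <[v]>%VS.
Proof.
move=> unitQ u0 v0 uu vv uv.
have [c0|c0] := eqVneq (cross u v) 0.
  have [k uE] := cross_eq0 v0 c0; rewrite uE vlineZ //.
  by apply: contraNneq u0; rewrite uE => ->; rewrite scale0r.
have [|k uQ] := cross_eq0 (u := u *m Q) c0.
  by apply: cross_cross; rewrite bil_mx ?uu ?uv raddf0.
have [|l vQ] := cross_eq0 (u := v *m Q) c0.
  by apply: cross_cross; rewrite bil_mx ?vv 1?bilC ?uv raddf0.
have l0 : l != 0.
  apply: contraNneq v0 => l0; rewrite -[v](mulmxK unitQ) vQ l0 scale0r.
  by rewrite mul0mx.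
have e : l *: u = k *: v.
  apply: (can_inj (mulmxK unitQ)).
  by rewrite -!scalemxAl uQ vQ !scalerA mulrC.
have : l *: cross u v = 0 by rewrite -crossZl e crossZl crossvv scaler0.
by move/eqP; rewrite scaler_eq0 (negPf l0) (negPf c0).
Qed.

(** Pairing the dependency with [u], [v], [w] gives a linear system whose matrix is the Gram matrix,
    of determinant [2 * bil u v * bil u w * bil v w]. The combinations below eliminate two unknowns
    at a time. *)
Lemma isotropic_free3 u v w x y z : (2 : F) != 0 ->
  bil u u = 0 -> bil v v = 0 -> bil w w = 0 ->
  bil u v != 0 -> bil u w != 0 -> bil v w != 0 ->
  x *: u + (y *: v + z *: w) = 0 -> [/\ x = 0, y = 0 & z = 0].
Proof.
move=> char2 uu vv ww uv uw vw lin0.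
have bil_lin t : x * bil u t + (y * bil v t + z * bil w t) = 0.
  by rewrite -!bilZl -!bilDl lin0 bil0l.
have := bil_lin w; have := bil_lin v; have := bil_lin u.
rewrite uu vv ww (bilC v u) (bilC w u) (bilC w v) => eu ev ew.
have cancel3 (p q r : F) : p != 0 -> q != 0 -> 2 * p * q * r = 0 -> r = 0.
  move=> p0 q0 /eqP; rewrite !mulf_eq0 (negPf char2) (negPf p0) (negPf q0).
  by move/eqP.
split.
- apply: (cancel3 _ _ _ uv uw).
  transitivity (bil u w * (x * bil u v + (y * 0 + z * bil v w))
    + bil u v * (x * bil u w + (y * bil v w + z * 0))
    - bil v w * (x * 0 + (y * bil u v + z * bil u w))); first by ring.
  by rewrite eu ev ew; ring.
- apply: (cancel3 _ _ _ uv vw).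
  transitivity (bil u v * (x * bil u w + (y * bil v w + z * 0))
    + bil v w * (x * 0 + (y * bil u v + z * bil u w))
    - bil u w * (x * bil u v + (y * 0 + z * bil v w))); first by ring.
  by rewrite eu ev ew; ring.
- apply: (cancel3 _ _ _ uw vw).
  transitivity (bil u w * (x * bil u v + (y * 0 + z * bil v w))
    + bil v w * (x * 0 + (y * bil u v + z * bil u w))
    - bil u v * (x * bil u w + (y * bil v w + z * 0))); first by ring.
  by rewrite eu ev ew; ring.
Qed.

Lemma point_span (P : {vspace 'rV[F]_3}) : on_conic Q P ->
  exists2 u, u != 0 & P = <[u]>%VS /\ bil u u = 0.
Proof.
case=> dimP isoP; have P0 : P != 0%VS by rewrite -dimv_eq0 dimP.
exists (vpick P); first by rewrite vpick0.
split; last by rewrite /bil isoP ?memv_pick // mxE.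
apply/eqP; rewrite eq_sym eqEdim dim_vline vpick0 P0 dimP andbT.
by rewrite -memvE memv_pick.
Qed.

(* Rescaling the spanning vectors [a1], ..., [a4] turns their linear dependency
   into [a1 + a3 = a2 + a4]; the frame is then [(a1 - a2)/2], [(a2 - a3)/2],
   [(a1 + a3)/2], spanning the vertices of the diagonal triangle. *)
Lemma diagonal_frame A1 A2 A3 A4 : (2 : F) != 0 -> \det Q != 0 ->
  on_conic Q A1 -> on_conic Q A2 -> on_conic Q A3 -> on_conic Q A4 ->
  uniq [:: A1; A2; A3; A4] ->
  exists E a b c,
    [/\ E \in unitmx, [&& a != 0, b != 0 & c != 0], a + b + c = 0,
        E *m Q *m E^T = diag_mx (vec3 a b c) &
        [/\ A1 = pt E (vec3 1 1 1), A2 = pt E (vec3 (-1) 1 1),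
            A3 = pt E (vec3 (-1) (-1) 1) & A4 = pt E (vec3 1 (-1) 1)]].
Proof.
move=> char2 detQ /point_span[a1 a1n [-> b11]] /point_span[a2 a2n [-> b22]].
move=> /point_span[a3 a3n [-> b33]] /point_span[a4 a4n [-> b44]].
have unitQ : Q \in unitmx by rewrite unitmxE unitfE.
rewrite /= !inE !negb_or andbT => /and3P[/and3P[d12 d13 d14] /andP[d23 d24] d34].
(* Distinct points of the conic are not conjugate, so all six pairings of the spanning vectors are
   nonzero. *)
have nb u v : u != 0 -> v != 0 -> bil u u = 0 -> bil v v = 0 ->
    <[u]>%VS != <[v]>%VS -> bil u v != 0.
  by move=> u0 v0 uu vv; apply: contraNneq => /isotropic_span->.
have {d12} b12 := nb _ _ a1n a2n b11 b22 d12.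
have {d13} b13 := nb _ _ a1n a3n b11 b33 d13.
have {d14} b14 := nb _ _ a1n a4n b11 b44 d14.
have {d23} b23 := nb _ _ a2n a3n b22 b33 d23.
have {d24} b24 := nb _ _ a2n a4n b22 b44 d24.
have {d34 nb} b34 := nb _ _ a3n a4n b33 b44 d34.
have [//|x x0] := @exists_kernel 4 3 (\matrix_(i < 4) [:: a1; a2; a3; a4]`_i).
rewrite mulmx_sum_row !big_ord_recl big_ord0 addr0 !rowK /=.
set x1 := x 0 _; set x2 := x 0 _; set x3 := x 0 _; set x4 := x 0 _ => lin0.
have xE i : x 0 i \in [:: x1; x2; x3; x4].
  rewrite !inE; case: i => [[|[|[|[|//]]]] lti]; apply/or4P;
  [constructor 1 | constructor 2 | constructor 3 | constructor 4];
  by apply/eqP; congr (x 0 _); apply: val_inj.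
have xn0 : ~ (x1 = 0 /\ x2 = 0 /\ x3 = 0 /\ x4 = 0).
  move=> [z1 [z2 [z3 z4]]]; case/eqP: x0; apply/rowP => i; rewrite [RHS]mxE.
  by move: (xE i); rewrite z1 z2 z3 z4 !inE !orbb => /eqP.
(* A vanishing coefficient would leave a dependency among three isotropic, pairwise non-orthogonal
   vectors, and then all four coefficients would vanish. *)
have x1n : x1 != 0.
  apply/eqP => z1; apply: xn0; move: lin0; rewrite z1 scale0r add0r.
  by case/isotropic_free3 => // -> -> ->.
have x2n : x2 != 0.
  apply/eqP => z2; apply: xn0; move: lin0; rewrite z2 scale0r add0r.
  by case/isotropic_free3 => // -> -> ->.
have x3n : x3 != 0.
  apply/eqP => z3; apply: xn0; move: lin0; rewrite z3 scale0r add0r.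
  by case/isotropic_free3 => // -> -> ->.
have x4n : x4 != 0.
  apply/eqP => z4; apply: xn0; move: lin0; rewrite z4 scale0r addr0.
  by case/isotropic_free3 => // -> -> ->.
pose c1 := x1 *: a1; pose c2 := - x2 *: a2; pose c3 := x3 *: a3.
have e4 : - x4 *: a4 = c1 - c2 + c3.
  apply/eqP; rewrite -subr_eq0 -[X in _ == X]oppr0 -lin0.
  by rewrite /c1 /c2 /c3 !scaleNr; apply/eqP/rowP => i; rewrite !mxE; ring.
have ci1 : bil c1 c1 = 0 by rewrite !bilE b11; ring.
have ci2 : bil c2 c2 = 0 by rewrite !bilE b22; ring.
have ci3 : bil c3 c3 = 0 by rewrite !bilE b33; ring.
have n12 : bil c1 c2 != 0 by rewrite !bilE !mulf_neq0 // oppr_eq0.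
have n13 : bil c1 c3 != 0 by rewrite !bilE !mulf_neq0 // oppr_eq0.
have n23 : bil c2 c3 != 0 by rewrite !bilE !mulf_neq0 // oppr_eq0.
have E1 : <[a1]>%VS = <[c1]>%VS by rewrite vlineZ.
have E2 : <[a2]>%VS = <[c2]>%VS by rewrite vlineZ // oppr_eq0.
have E3 : <[a3]>%VS = <[c3]>%VS by rewrite vlineZ.
have E4 : <[a4]>%VS = <[c1 - c2 + c3]>%VS by rewrite -e4 vlineZ // oppr_eq0.
have iso4 : bil (c1 - c2 + c3) (c1 - c2 + c3) = 0.
  by rewrite -e4 !bilE b44; ring.
rewrite E1 E2 E3 E4.
(* From here on only the isotropy of [c1], [c2], [c3] and [c1 - c2 + c3] and the nonzero pairings
   matter. *)
move: (c1) (c2) (c3) n12 n13 n23 ci1 ci2 ci3 iso4 => {E1 E2 E3 E4 e4 c1 c2 c3}.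
move=> c1 c2 c3 n12 n13 n23 ci1 ci2 ci3 iso4.
(* Expanding the isotropy of [c1 - c2 + c3] gives twice this relation. It kills every off-diagonal
   entry of the Gram matrix of the frame and also yields [a + b + c = 0]. *)
have c4 : bil c1 c3 = bil c1 c2 + bil c2 c3.
  move: iso4; rewrite -!(scaleN1r c2) !bilE ci1 ci2 ci3.
  rewrite (bilC c2 c1) (bilC c3 c1) (bilC c3 c2) => e.
  apply: (mulfI char2); apply/eqP; rewrite -subr_eq0 -[X in _ == X]e.
  by apply/eqP; ring.
pose m1 := 2^-1 *: (c1 + -1 *: c2); pose m2 := 2^-1 *: (c2 + -1 *: c3).
pose m3 := 2^-1 *: (c1 + c3).
have nz (p : F) : p != 0 -> 2^-1 * p != 0 by move=> ?; rewrite mulf_neq0 ?invr_eq0.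
have eqD : mx3 m1 m2 m3 *m Q *m (mx3 m1 m2 m3)^T =
    diag_mx (vec3 (- (2^-1 * bil c1 c2)) (- (2^-1 * bil c2 c3)) (2^-1 * bil c1 c3)).
  apply/matrixP => i j.
  have -> : (mx3 m1 m2 m3 *m Q *m (mx3 m1 m2 m3)^T) i j
      = bil (row i (mx3 m1 m2 m3)) (row j (mx3 m1 m2 m3)).
    rewrite /bil tr_row -row_mul !mxE; apply: eq_bigr => k _.
    by rewrite !mxE; congr (_ * _); apply: eq_bigr => l _; rewrite !mxE.
  rewrite !rowK !mxE.
  case: i => [[|[|[|//]]] lti]; case: j => [[|[|[|//]]] ltj];
    rewrite /= /m1 /m2 /m3 !bilE ?ci1 ?ci2 ?ci3 ?(bilC c2 c1) ?(bilC c3 c1);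
    rewrite ?(bilC c3 c2) ?c4 ?mulr0n ?mulr1n; by field.
exists (mx3 m1 m2 m3), (- (2^-1 * bil c1 c2)), (- (2^-1 * bil c2 c3)), (2^-1 * bil c1 c3).
split.
(* The determinant of the diagonal matrix is a product of nonzero entries, so the frame is
   invertible. *)
- have := congr1 determinant eqD; rewrite !det_mulmx det_diag !big_ord_recl big_ord0 !mxE /=.
  move=> eD; rewrite unitmxE unitfE.
  have: \det (mx3 m1 m2 m3) * \det Q * \det (mx3 m1 m2 m3)^T != 0.
    by rewrite eD !mulf_neq0 ?oppr_eq0 ?mulf_neq0 ?invr_eq0 ?oner_eq0.
  by rewrite !mulf_eq0 !negb_or => /andP[/andP[]].
- by rewrite !oppr_eq0 !nz.
- by rewrite c4; ring.
- exact: eqD.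
- rewrite /pt !mul_vec3_mx3; split; congr <[_]>%VS; apply/rowP => i;
    rewrite !mxE; by field.
Qed.

End NormalForm.

(** * Incidences computed from explicit coordinates *)

Section Incidence.
Variables (F : fieldType) (E : 'M[F]_3).
Hypothesis unitE : E \in unitmx.
Implicit Types (u v w : 'rV[F]_3) (a b c d : F).

Lemma line_ptE k u v w :
  k != 0 -> w != 0 -> cross u v = k *: w -> line (pt E u) (pt E v) = ln E w.
Proof.
by move=> k0 w0 e; rewrite line_pt // e ?lnZ // scaler_eq0 (negPf k0).
Qed.

Lemma meet_lnE k u v w :
  k != 0 -> w != 0 -> cross u v = k *: w -> meet (ln E u) (ln E v) = pt E w.
Proof.
by move=> k0 w0 e; rewrite meet_ln // e ?ptZ // scaler_eq0 (negPf k0).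
Qed.

Lemma line_meets_vec3 x y z p q r a b c :
  a * (y * r - z * q) + b * (z * p - x * r) + c * (x * q - y * p) != 0 ->
  line (meet (ln E (vec3 x y z)) (ln E (vec3 p q r)))
       (meet (ln E (vec3 x y z)) (ln E (vec3 a b c))) = ln E (vec3 x y z).
Proof.
move=> d0; apply: line_meets => //; rewrite cross_vec3 mul_vec3_tr mxE mulr1n.
by rewrite ![_ * a]mulrC ![_ * b]mulrC ![_ * c]mulrC.
Qed.

(** In frame coordinates this is the form [a x^2 + b y^2 + c z^2 + 2 d x y], a family containing all
    six conics sought; the congruence by [invmx E] carries it back to the original coordinates. *)
Definition conic_mx a b c d : 'M[F]_3 :=
  invmx E *m mx3 (vec3 a d 0) (vec3 d b 0) (vec3 0 0 c) *m (invmx E)^T.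

Lemma is_conic_mx a b c d :
  [|| a != 0, b != 0 | c != 0] -> is_conic (conic_mx a b c d).
Proof.
move=> n0; have symC : (mx3 (vec3 a d 0) (vec3 d b 0) (vec3 0 0 c))^T
    = mx3 (vec3 a d 0) (vec3 d b 0) (vec3 0 0 c).
  apply/matrixP => i j; rewrite !mxE.
  by case: i => [[|[|[|//]]] lti]; case: j => [[|[|[|//]]] ltj]; rewrite !mxE.
split; first by rewrite /conic_mx !trmx_mul trmxK symC mulmxA.
apply: contraTneq n0 => e; rewrite !negb_or !negbK.
have : E *m conic_mx a b c d *m E^T = 0 by rewrite e mulmx0 mul0mx.
rewrite /conic_mx !mulmxA mulmxV // mul1mx -mulmxA -trmx_mul mulmxV //.
rewrite trmx1 mulmx1 => /matrixP C0.
by have := (C0 0 0, C0 1 1, C0 2 2); rewrite !mxE /= => -[[-> ->] ->]; rewrite eqxx.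
Qed.

(** The equation is the form evaluated at the cross product of the two lines. A nonzero third
    coordinate ensures that the lines are distinct. *)
Lemma meet_on_conic a b c d p q r p' q' r' :
  p * q' - q * p' != 0 ->
  a * (q * r' - r * q') ^+ 2 + b * (r * p' - p * r') ^+ 2
    + c * (p * q' - q * p') ^+ 2
    + 2 * d * (q * r' - r * q') * (r * p' - p * r') = 0 ->
  on_conic (conic_mx a b c d) (meet (ln E (vec3 p q r)) (ln E (vec3 p' q' r'))).
Proof.
move=> n0 e; have c0 : cross (vec3 p q r) (vec3 p' q' r') != 0.
  by rewrite cross_vec3 vec3_eq0 (negPf n0) !andbF.
rewrite meet_ln //; apply: pt_on_conic => //.
rewrite cross_vec3 mul_vec3_mx3 !scale_vec3.
have addv x y z x' y' z' :
    vec3 x y z + vec3 x' y' z' = vec3 (x + x') (y + y') (z + z') :> 'rV[F]_3.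
  by apply/rowP => i; rewrite !mxE; case: i => [[|[|[|//]]] lti].
rewrite !addv mul_vec3_tr [X in X%:M](_ : _ = 0) ?raddf0 //.
by apply: etrans e; ring.
Qed.

Lemma common_conic a b c d (s : seq {vspace 'rV[F]_3}) :
  [|| a != 0, b != 0 | c != 0] ->
  foldr (fun P A => on_conic (conic_mx a b c d) P /\ A) True s ->
  on_common_conic s.
Proof.
move=> n0 onC; exists (conic_mx a b c d); split; first exact: is_conic_mx.
elim: s onC => //= P s IHs [onP ons] P'; rewrite inE.
by case/orP => [/eqP->|]; [| exact: IHs].
Qed.

(** Two homogeneous linear conditions on three unknowns have a nonzero solution. With squared
    coordinates of two points as data, it gives a diagonal conic through both. *)
Lemma diag_conic_exists a b c a' b' c' : exists x y z,
  [/\ [|| x != 0, y != 0 | z != 0], x * a + y * b + z * c = 0 &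
      x * a' + y * b' + z * c' = 0] :> Prop.
Proof.
have [x [y [z [n0 [e1 e2]]]]] := exists_orthogonal (vec3 a b c) (vec3 a' b' c').
exists x, y, z; split.
- by move: n0; rewrite vec3_eq0 !negb_and.
- by move/matrixP/(_ 0 0): e1; rewrite mul_vec3_tr !mxE mulr1n.
- by move/matrixP/(_ 0 0): e2; rewrite mul_vec3_tr !mxE mulr1n.
Qed.

(** * The sixteen intersection points and their six conics *)

Section Sixteen.
Variables e f : F.
Hypotheses (e0 : e != 0) (f0 : f != 0) (ef : e ^+ 2 + f ^+ 2 = 1).

Let t1 := ln E (vec3 (f ^+ 2) (e ^+ 2) (- 1)).
Let t2 := ln E (vec3 (- f ^+ 2) (e ^+ 2) (- 1)).
Let t3 := ln E (vec3 (f ^+ 2) (e ^+ 2) 1).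
Let t4 := ln E (vec3 (f ^+ 2) (- e ^+ 2) (- 1)).
(** [L1], [L2], [L3], [L4] will be the successive sides [Z1 Z2], [Z2 Z3], [Z3 Z4], [Z4 Z1]. *)
Let L1 := ln E (vec3 0 e (- 1)).
Let L2 := ln E (vec3 f 0 1).
Let L3 := ln E (vec3 0 e 1).
Let L4 := ln E (vec3 f 0 (- 1)).

Let nzP x : [\/ x = e * f ^+ 2, x = - (e * f ^+ 2), x = f * e ^+ 2 |
                x = - (f * e ^+ 2)] -> x != 0.
Proof. by case=> ->; rewrite ?oppr_eq0 mulf_neq0 ?expf_neq0. Qed.

(* Up to sign, the third coordinate of each of the sixteen points is [e f^2]
   or [f e^2]. *)
Ltac nonzero := apply: nzP; first
  [by constructor 1; ring | by constructor 2; ring |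
   by constructor 3; ring | by constructor 4; ring].

(* The sign changes of the coordinates distribute the sixteen points into four
   orbits of four.  A diagonal conic that contains a point contains its orbit,
   and there is one through any two points. *)
Let diag_conic_through s1 s2 : exists a b c,
  [/\ [|| a != 0, b != 0 | c != 0],
     a * (e ^+ 2 - s1 * e) ^+ 2 + b * f ^+ 4 + c * (e ^+ 2 * f ^+ 4) = 0 &
     a * e ^+ 4 + b * (f ^+ 2 - s2 * f) ^+ 2 + c * (f ^+ 2 * e ^+ 4) = 0].
Proof. exact: diag_conic_exists. Qed.

Ltac diag_conic h1 h2 := rewrite /=;
  do 8 (split;
    [apply: meet_on_conic;
      [nonzero | first [apply: etrans h1; ring | apply: etrans h2; ring]] | ]);
  exact: I.

Lemma common_conic1 : on_common_conic
  [:: meet L1 t1; meet L1 t2; meet L2 t2; meet L2 t3;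
      meet L3 t3; meet L3 t4; meet L4 t4; meet L4 t1].
Proof.
(* The first sign selects the orbit of [meet L1 t1] (for 1) or of [meet L1 t3] (for -1), the second
   that of [meet L2 t2] (for 1) or of [meet L2 t4] (for -1). The four sign pairs give the first four
   groups. *)
have [a [b [c [n0 h1 h2]]]] := diag_conic_through (1 : F) (1 : F).
by apply: (common_conic (d := 0) n0); diag_conic h1 h2.
Qed.

Lemma common_conic2 : on_common_conic
  [:: meet L1 t3; meet L3 t2; meet L2 t4; meet L4 t3;
      meet L3 t1; meet L1 t4; meet L4 t2; meet L2 t1].
Proof.
have [a [b [c [n0 h1 h2]]]] := diag_conic_through (- 1 : F) (- 1 : F).
by apply: (common_conic (d := 0) n0); diag_conic h1 h2.
Qed.

Lemma common_conic3 : on_common_conic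
  [:: meet L1 t1; meet L1 t2; meet L3 t3; meet L3 t4;
      meet L2 t4; meet L4 t3; meet L4 t2; meet L2 t1].
Proof.
have [a [b [c [n0 h1 h2]]]] := diag_conic_through (1 : F) (- 1 : F).
by apply: (common_conic (d := 0) n0); diag_conic h1 h2.
Qed.

Lemma common_conic4 : on_common_conic
  [:: meet L2 t2; meet L2 t3; meet L4 t4; meet L4 t1;
      meet L1 t3; meet L3 t2; meet L3 t1; meet L1 t4].
Proof.
have [a [b [c [n0 h1 h2]]]] := diag_conic_through (- 1 : F) (1 : F).
by apply: (common_conic (d := 0) n0); diag_conic h1 h2.
Qed.

(** The mixed conics contain their points only modulo the relation [ef]: at each point the form
    equals [e^2 f^4] or [e^4 f^2], up to sign, times [e^2 + f^2 - 1]. *)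
Let efM k : k * (e ^+ 2 + f ^+ 2 - 1) = 0. Proof. by rewrite ef subrr mulr0. Qed.

Ltac mixed_conic s :=
  apply: (@common_conic (f ^+ 4) (- e ^+ 4) (e ^+ 2 - f ^+ 2)
    (s * (e ^+ 2 * f ^+ 2))) => /=; [by rewrite (expf_neq0 _ f0) |];
  do 8 (split;
    [apply: meet_on_conic;
      [nonzero | first
        [ apply: etrans (efM (e ^+ 2 * f ^+ 4)); ring
        | apply: etrans (efM (- e ^+ 2 * f ^+ 4)); ring
        | apply: etrans (efM (e ^+ 4 * f ^+ 2)); ring
        | apply: etrans (efM (- e ^+ 4 * f ^+ 2)); ring ]] | ]);
  exact: I.

(** The group has two points from each orbit, exchanged by reversing the signs of both [x] and [y],
    which preserves the term in [x y]. *)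
Lemma common_conic5 : on_common_conic
  [:: meet L1 t1; meet L2 t2; meet L3 t3; meet L4 t4;
      meet L1 t3; meet L2 t4; meet L3 t1; meet L4 t2].
Proof. mixed_conic (1 : F). Qed.

(** The sign change of [x] swaps [t1] with [t2], [t3] with [t4] and [L2] with [L4]. It carries the
    preceding group to this one and reverses the term in [x y]. *)
Lemma common_conic6 : on_common_conic
  [:: meet L1 t2; meet L2 t3; meet L3 t4; meet L4 t1;
      meet L3 t2; meet L4 t3; meet L1 t4; meet L2 t1].
Proof. mixed_conic (- 1 : F). Qed.

Hypothesis two0 : (2 : F) != 0.

Let n_ef : 2 * e * f != 0. Proof. by rewrite !mulf_neq0. Qed.
Let n_eeff : 4 * e ^+ 2 * f ^+ 2 != 0.
Proof.
have -> : 4 * e ^+ 2 * f ^+ 2 = (2 * e * f) ^+ 2 by ring.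
exact: expf_neq0.
Qed.

(** Up to sign, three of the lines [L1], ..., [L4] have determinant [2 e f], and three of the
    tangents [4 e^2 f^2]; so no three lines of either quadrilateral are concurrent. *)
Let detP x : [\/ x = 2 * e * f, x = - (2 * e * f),
    x = 4 * e ^+ 2 * f ^+ 2 | x = - (4 * e ^+ 2 * f ^+ 2)] -> x != 0.
Proof. by case=> ->; rewrite ?oppr_eq0. Qed.

Let meetC (L L' : {vspace 'rV[F]_3}) : meet L L' = meet L' L.
Proof. exact: capvC. Qed.

Ltac line_through_meets := apply: line_meets_vec3; apply: detP; first
  [by constructor 1; ring | by constructor 2; ring |
   by constructor 3; ring | by constructor 4; ring].

Lemma sides_of_contact_quadrilateral :
  [/\ line (meet L1 L4) (meet L1 L2) = L1, line (meet L1 L2) (meet L3 L2) = L2,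
      line (meet L3 L2) (meet L3 L4) = L3 & line (meet L1 L4) (meet L3 L4) = L4].
Proof.
split; first by line_through_meets.
- by rewrite !(meetC _ L2); line_through_meets.
- by line_through_meets.
- by rewrite !(meetC _ L4); line_through_meets.
Qed.

Lemma sides_of_tangent_quadrilateral :
  [/\ line (meet t1 t2) (meet t1 t4) = t1, line (meet t1 t2) (meet t2 t3) = t2,
      line (meet t3 t4) (meet t2 t3) = t3 & line (meet t3 t4) (meet t1 t4) = t4].
Proof.
split; first by line_through_meets.
- by rewrite (meetC t1); line_through_meets.
- by rewrite (meetC t2); line_through_meets.
- by rewrite !(meetC _ t4); line_through_meets.
Qed.

End Sixteen.

(** * Tangents and contact points of a diagonal conic *)

Section Contact.
Variables (Q : 'M[F]_3) (a b c : F).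
Hypotheses (a0 : a != 0) (b0 : b != 0) (c0 : c != 0).
Hypothesis eqD : E *m Q *m E^T = diag_mx (vec3 a b c).

Lemma tangent_vec3 k x y z w : k != 0 -> vec3 x y z != 0 ->
  vec3 (x * a) (y * b) (z * c) = k *: w ->
  tangent Q (pt E (vec3 x y z)) = ln E w.
Proof.
by move=> k0 n0 e; rewrite (tangent_pt unitE eqD) // mul_vec3_diag e lnZ.
Qed.

Lemma contact_point_coord U m : contact_point Q (pt E m) U -> exists x y z,
  [/\ vec3 x y z != 0, U = pt E (vec3 x y z),
      a * x ^+ 2 + b * y ^+ 2 + c * z ^+ 2 = 0 &
      m *m (vec3 (x * a) (y * b) (z * c))^T = 0].
Proof.
case=> onU; have [u u0 eU] := ptP unitE onU.1; subst U.
have [x [y [z eu]]] := vec3P u; subst u.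
rewrite (tangent_pt unitE eqD u0) pt_sub_ln // mul_vec3_diag => /eqP mu.
exists x, y, z; split => //.
have := on_conic_pt onU; rewrite eqD mul_vec3_diag mul_vec3_tr.
move/matrixP/(_ 0 0); rewrite !mxE mulr1n => <-; ring.
Qed.

(** The polar of the first frame vertex is [x = 0]. A contact point with also [y = 0] would satisfy
    [c z^2 = 0], so [y] can be scaled to 1. *)
Lemma contact_point1 U : contact_point Q (pt E (vec3 1 0 0)) U ->
  exists2 e, b + c * e ^+ 2 = 0 & U = pt E (vec3 0 1 e).
Proof.
case/contact_point_coord => x [y [z [n0 -> q0]]].
rewrite mul_vec3_tr => /matrixP/(_ 0 0); rewrite !mxE mulr1n.
rewrite mul1r !mul0r !addr0 => /eqP; rewrite mulf_eq0 (negPf a0) orbF => /eqP x0.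
subst x; have y0 : y != 0.
  apply: contraNneq n0 => y0; subst y; move: q0.
  rewrite !expr0n /= !mulr0 !add0r => /eqP.
  by rewrite mulf_eq0 (negPf c0) expf_eq0 vec3_eq0 eqxx.
exists (z / y).
  apply: (mulIf (expf_neq0 2 y0)); rewrite mul0r -[RHS]q0.
  by rewrite mulrDl exprMn exprVn; field.
rewrite -(ptZ E (vec3 0 1 _) y0) scale_vec3; congr (pt E (vec3 _ _ _)).
all: by field.
Qed.

Lemma contact_point2 V : contact_point Q (pt E (vec3 0 1 0)) V ->
  exists2 f, a + c * f ^+ 2 = 0 & V = pt E (vec3 1 0 f).
Proof.
case/contact_point_coord => x [y [z [n0 -> q0]]].
rewrite mul_vec3_tr => /matrixP/(_ 0 0); rewrite !mxE mulr1n.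
rewrite mul1r !mul0r addr0 add0r => /eqP.
rewrite mulf_eq0 (negPf b0) orbF => /eqP y0.
subst y; have x0 : x != 0.
  apply: contraNneq n0 => x0; subst x; move: q0.
  rewrite !expr0n /= !mulr0 !add0r => /eqP.
  by rewrite mulf_eq0 (negPf c0) expf_eq0 vec3_eq0 eqxx.
exists (z / x).
  apply: (mulIf (expf_neq0 2 x0)); rewrite mul0r -[RHS]q0.
  by field.
rewrite -(ptZ E (vec3 1 0 _) x0) scale_vec3; congr (pt E (vec3 _ _ _)).
all: by field.
Qed.

End Contact.
End Incidence.

(** * Reduction of the complex configuration to frame coordinates *)

Local Open Scope complex_scope.

Theorem theorem5p2 (R : realType) (Q : 'M[R[i]]_3)
    (A1 A2 A3 A4 U1 U2 V1 V2 : {vspace 'rV[R[i]]_3}) :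
  nondegenerate_conic Q ->
  on_conic Q A1 -> on_conic Q A2 -> on_conic Q A3 -> on_conic Q A4 ->
  uniq [:: A1; A2; A3; A4] ->
  let t1 := tangent Q A1 in
  let t2 := tangent Q A2 in
  let t3 := tangent Q A3 in
  let t4 := tangent Q A4 in
  let M1 := meet (line A1 A2) (line A3 A4) in
  let M2 := meet (line A2 A3) (line A4 A1) in
  let N1 := meet t1 t2 in
  let P1 := meet t3 t4 in
  let N2 := meet t1 t4 in
  let P2 := meet t2 t3 in
  contact_point Q M1 U1 -> contact_point Q M1 U2 -> U1 != U2 ->
  contact_point Q M2 V1 -> contact_point Q M2 V2 -> V1 != V2 ->
  let Z1 := meet (line M1 U1) (line M2 V1) in
  let Z2 := meet (line M1 U1) (line M2 V2) in
  let Z3 := meet (line M1 U2) (line M2 V2) in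
  let Z4 := meet (line M1 U2) (line M2 V1) in
  let R1 := meet (line Z1 Z2) (line N1 N2) in
  let R2 := meet (line Z1 Z2) (line N1 P2) in
  let R3 := meet (line Z2 Z3) (line N1 P2) in
  let R4 := meet (line Z2 Z3) (line P1 P2) in
  let R5 := meet (line Z3 Z4) (line P1 P2) in
  let R6 := meet (line Z3 Z4) (line P1 N2) in
  let R7 := meet (line Z1 Z4) (line P1 N2) in
  let R8 := meet (line Z1 Z4) (line N1 N2) in
  let R9 := meet (line Z1 Z2) (line P1 P2) in
  let R10 := meet (line Z3 Z4) (line N1 P2) in
  let R11 := meet (line Z2 Z3) (line P1 N2) in
  let R12 := meet (line Z1 Z4) (line P1 P2) in
  let R13 := meet (line Z3 Z4) (line N1 N2) in
  let R14 := meet (line Z1 Z2) (line P1 N2) in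
  let R15 := meet (line Z1 Z4) (line N1 P2) in
  let R16 := meet (line Z2 Z3) (line N1 N2) in
  on_common_conic [:: R1; R2; R3; R4; R5; R6; R7; R8] /\
  on_common_conic [:: R9; R10; R11; R12; R13; R14; R15; R16] /\
  on_common_conic [:: R1; R2; R5; R6; R11; R12; R15; R16] /\
  on_common_conic [:: R3; R4; R7; R8; R9; R10; R13; R14] /\
  on_common_conic [:: R1; R3; R5; R7; R9; R11; R13; R15] /\
  on_common_conic [:: R2; R4; R6; R8; R10; R12; R14; R16].

Proof.
move=> [symQ detQ] onA1 onA2 onA3 onA4 uniqA.
have two0 : (2 : R[i]) != 0 by rewrite Num.Theory.pnatr_eq0.
have [E [a [b [c [unitE /and3P[a0 b0 c0] abc eqD [eA1 eA2 eA3 eA4]]]]]] :=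
  diagonal_frame symQ two0 detQ onA1 onA2 onA3 onA4 uniqA.
move=> t1 t2 t3 t4 M1 M2 N1 P1 N2 P2 cU1 cU2 U12 cV1 cV2 V12.
move=> Z1 Z2 Z3 Z4.
have vn0 (x y z : R[i]) : [|| x != 0, y != 0 | z != 0] -> vec3 x y z != 0.
  by rewrite vec3_eq0 !negb_and.
have eM1 : M1 = pt E (vec3 1 0 0).
  rewrite /M1 eA1 eA2 eA3 eA4.
  rewrite (line_ptE unitE (w := vec3 0 (- 1) 1) two0); first 1 last.
  - by apply: vn0; rewrite oner_eq0 !orbT.
  - by rewrite cross_vec3 scale_vec3; congr vec3; ring.
  rewrite (line_ptE unitE (w := vec3 0 1 1) two0); first 1 last.
  - by apply: vn0; rewrite oner_eq0 !orbT.
  - by rewrite cross_vec3 scale_vec3; congr vec3; ring.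
  apply: (meet_lnE unitE (k := - 2)); first by rewrite oppr_eq0.
  - by apply: vn0; rewrite oner_eq0.
  - by rewrite cross_vec3 scale_vec3; congr vec3; ring.
have eM2 : M2 = pt E (vec3 0 1 0).
  rewrite /M2 eA1 eA2 eA3 eA4.
  rewrite (line_ptE unitE (w := vec3 1 0 1) two0); first 1 last.
  - by apply: vn0; rewrite oner_eq0 !orbT.
  - by rewrite cross_vec3 scale_vec3; congr vec3; ring.
  rewrite (line_ptE unitE (w := vec3 (- 1) 0 1) two0); first 1 last.
  - by apply: vn0; rewrite oner_eq0 !orbT.
  - by rewrite cross_vec3 scale_vec3; congr vec3; ring.
  apply: (meet_lnE unitE (k := - 2)); first by rewrite oppr_eq0.
  - by apply: vn0; rewrite oner_eq0 orbT.
  - by rewrite cross_vec3 scale_vec3; congr vec3; ring.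
move: cU1 cU2 cV1 cV2; rewrite eM1 eM2.
case/(contact_point1 unitE a0 c0 eqD) => e he eU1.
case/(contact_point1 unitE a0 c0 eqD) => e' he' eU2.
case/(contact_point2 unitE b0 c0 eqD) => f hf eV1.
case/(contact_point2 unitE b0 c0 eqD) => f' hf' eV2.
(* The two contact points from one vertex correspond to distinct roots of the same equation without
   linear term, so the roots are opposite. *)
have opp_root (k x x' : R[i]) : k + c * x ^+ 2 = 0 -> k + c * x' ^+ 2 = 0 ->
    x != x' -> x' = - x.
  move=> hx hx' xx'; have : c * ((x' + x) * (x - x')) = 0.
    by transitivity ((k + c * x ^+ 2) - (k + c * x' ^+ 2)); [ring | rewrite hx hx' subrr].
  move/eqP; rewrite !mulf_eq0 (negPf c0) subr_eq0 (negPf xx') orbF addr_eq0.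
  by move/eqP.
have ee' : e' = - e.
  by apply: (opp_root b) => //; apply: contraNneq U12; rewrite eU1 eU2 => ->.
have ff' : f' = - f.
  by apply: (opp_root a) => //; apply: contraNneq V12; rewrite eV1 eV2 => ->.
subst e' f'; move: eU2 eV2 => eU2 eV2 {he' hf'}.
have e0 : e != 0.
  by apply: contraNneq b0 => e0; rewrite -he e0 expr0n mulr0 addr0.
have f0 : f != 0.
  by apply: contraNneq a0 => f0; rewrite -hf f0 expr0n mulr0 addr0.
have be : b = - c * e ^+ 2.
  by apply/eqP; rewrite -subr_eq0 -he; apply/eqP; ring.
have af : a = - c * f ^+ 2.
  by apply/eqP; rewrite -subr_eq0 -hf; apply/eqP; ring.
(* Substituting [a = - c f^2] and [b = - c e^2] turns [a + b + c = 0] into this relation times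
   [- c]. *)
have ef : e ^+ 2 + f ^+ 2 = 1.
  apply/eqP; rewrite -subr_eq0; have : - c * (e ^+ 2 + f ^+ 2 - 1) = 0.
    by rewrite -abc be af; ring.
  by move/eqP; rewrite mulf_eq0 oppr_eq0 (negPf c0).
have nc0 : - c != 0 by rewrite oppr_eq0.
have et1 : t1 = ln E (vec3 (f ^+ 2) (e ^+ 2) (- 1)).
  rewrite /t1 eA1; apply: (tangent_vec3 unitE eqD nc0).
    by apply: vn0; rewrite oner_eq0 !orbT.
  by rewrite scale_vec3 af be; congr vec3; ring.
have et2 : t2 = ln E (vec3 (- f ^+ 2) (e ^+ 2) (- 1)).
  rewrite /t2 eA2; apply: (tangent_vec3 unitE eqD nc0).
    by apply: vn0; rewrite oner_eq0 !orbT.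
  by rewrite scale_vec3 af be; congr vec3; ring.
have et3 : t3 = ln E (vec3 (f ^+ 2) (e ^+ 2) 1).
  rewrite /t3 eA3; apply: (tangent_vec3 unitE eqD c0).
    by apply: vn0; rewrite oner_eq0 !orbT.
  by rewrite scale_vec3 af be; congr vec3; ring.
have et4 : t4 = ln E (vec3 (f ^+ 2) (- e ^+ 2) (- 1)).
  rewrite /t4 eA4; apply: (tangent_vec3 unitE eqD nc0).
    by apply: vn0; rewrite oner_eq0 !orbT.
  by rewrite scale_vec3 af be; congr vec3; ring.
have n1 : (1 : R[i]) != 0 := oner_neq0 _.
have nN1 : (- 1 : R[i]) != 0 by rewrite oppr_eq0.
have eL1 : line M1 U1 = ln E (vec3 0 e (- 1)).
  rewrite eM1 eU1; apply: (line_ptE unitE nN1).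
    by apply: vn0; rewrite e0 orbT.
  by rewrite cross_vec3 scale_vec3; congr vec3; ring.
have eL3 : line M1 U2 = ln E (vec3 0 e 1).
  rewrite eM1 eU2; apply: (line_ptE unitE n1).
    by apply: vn0; rewrite e0 orbT.
  by rewrite cross_vec3 scale_vec3; congr vec3; ring.
have eL4 : line M2 V1 = ln E (vec3 f 0 (- 1)).
  rewrite eM2 eV1; apply: (line_ptE unitE n1).
    by apply: vn0; rewrite f0.
  by rewrite cross_vec3 scale_vec3; congr vec3; ring.
have eL2 : line M2 V2 = ln E (vec3 f 0 1).
  rewrite eM2 eV2; apply: (line_ptE unitE nN1).
    by apply: vn0; rewrite f0.
  by rewrite cross_vec3 scale_vec3; congr vec3; ring.
have [sL1 sL2 sL3 sL4] := sides_of_contact_quadrilateral unitE e0 f0 two0.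
have [st1 st2 st3 st4] := sides_of_tangent_quadrilateral unitE e0 f0 two0.
(* Two consecutive vertices of either quadrilateral lie on a common side, and their join is that
   side; the sixteen points thus become meets of some [L] with some [t]. *)
have eZ12 : line Z1 Z2 = line M1 U1 by rewrite /Z1 /Z2 eL1 eL2 eL4.
have eZ23 : line Z2 Z3 = line M2 V2 by rewrite /Z2 /Z3 eL1 eL2 eL3.
have eZ34 : line Z3 Z4 = line M1 U2 by rewrite /Z3 /Z4 eL2 eL3 eL4.
have eZ14 : line Z1 Z4 = line M2 V1 by rewrite /Z1 /Z4 eL1 eL3 eL4.
have eNN : line N1 N2 = t1 by rewrite /N1 /N2 et1 et2 et4.
have eNP : line N1 P2 = t2 by rewrite /N1 /P2 et1 et2 et3.
have ePP : line P1 P2 = t3 by rewrite /P1 /P2 et2 et3 et4.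
have ePN : line P1 N2 = t4 by rewrite /P1 /N2 et1 et3 et4.
(* Otherwise unification compares coordinates by unfolding complex arithmetic. *)
clearbody Z1 Z2 Z3 Z4 N1 P1 N2 P2.
clearbody t1 t2 t3 t4 M1 M2.
rewrite eZ12 eZ23 eZ34 eZ14 eNN eNP ePP ePN.
rewrite eL1 eL2 eL3 eL4 et1 et2 et3 et4 /=.
split; first exact: (common_conic1 unitE e0 f0).
split; first exact: (common_conic2 unitE e0 f0).
split; first exact: (common_conic3 unitE e0 f0).
split; first exact: (common_conic4 unitE e0 f0).
split; first exact: (common_conic5 unitE e0 f0 ef).
exact: (common_conic6 unitE e0 f0 ef).
Qed.
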